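(* Let $\mathbf{F}/\mathbb{F}_2$ be an algebraic function field of genus $g$ with constant field $\mathbb{F}_2$ and with $1\le g\le 6$, and let $L(t)=\sum_{n=0}^{2g}a_nt^n$ be its $L$-polynomial. Suppose that $|N_1-3|=2g-2$ and that $(\alpha_1+\overline{\alpha_1},\ldots,\alpha_g+\overline{\alpha_g})=\pm(2,\ldots,2,0)$, so that $a_n=a_{n,\theta}$ with $\theta=\pi/4$ (sign $+$) or $\theta=3\pi/4$ (sign $-$). Then for $n\in\{0,\ldots,g\}$: (a) $a_{n,\pi/4}<0$ if $n$ is odd and $a_{n,\pi/4}>0$ if $n$ is even; (b) $a_{n,3\pi/4}>0$; (c) the sequence $|a_{n,\theta}|$, with $\theta=\pi/4$ or $3\pi/4$, is increasing (in $n\in\{0,\ldots,g\}$).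
   Context: The $L$-polynomial of $\mathbf{F}/\mathbb{F}_2$ is the numerator of its Zeta function, $L(t)=\prod_{i=1}^{g}(1-\alpha_it)(1-\overline{\alpha_i}t)$ with $|\alpha_i|=\sqrt2$. $N_1$ is the number of places of degree one of $\mathbf{F}/\mathbb{F}_2$. The tuple $(2,\ldots,2,0)$ has $g$ entries, $g-1$ of them equal to $2$ and the last equal to $0$; the sign $\pm$ is global. $\mathbb{P}(n)$ denotes the set of compositions of $n$, i.e. of all tuples $(m_1,\ldots,m_r)$ ($r\ge1$ arbitrary) of positive integers with $m_1+\cdots+m_r=n$; order matters. For $\theta\in\{\pi/4,3\pi/4\}$, $a_{0,\theta}=1$ and for $1\le n\le g$ $$a_{n,\theta}=\sum_{(m_1,\ldots,m_r)\in\mathbb{P}(n)}(-1)^r\cdot2^r\cdot2^{n/2}\prod_{s=1}^{r}\frac{(g-1)\cos(m_s\theta)+\cos(m_s\pi/2)}{m_1+\cdots+m_s}.$$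
   Formalization: Parts (a), (b), (c) are stated only for 2 ≤ g ≤ 6: for g = 1 they are false, since then a_{1,θ} = 0 (e.g. y²+y=x³ over F_2, with N_1 = 3 and L(t) = 1+2t²). The equality a_n = a_{n,θ} is kept for 1 ≤ g ≤ 6. *)

(* Defs.v *)
From HB Require Import structures.
From mathcomp Require Import all_boot all_order all_algebra.
From mathcomp Require Import finmap.
From mathcomp Require Import complex.
From mathcomp Require Import all_classical all_reals all_analysis.

Set Implicit Arguments.
Unset Strict Implicit.
Unset Printing Implicit Defensive.
Import Order.TTheory GRing.Theory Num.Theory.
Local Open Scope classical_set_scope.
Local Open Scope ring_scope.

(** Algebraic function fields of one variable, following Stichtenoth's
    "Algebraic Function Fields and Codes". A field extension F/K is given by
    its embedding [iota]. *)
Section FunctionField.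
Variables (K F : fieldType) (iota : {rmorphism K -> F}).

Definition algebraic (x : F) : Prop :=
  exists2 p : {poly K}, p != 0 & root (map_poly iota p) x.

(** The subfield K(x). *)
Definition simple_ext (x : F) : set F :=
  [set z | exists p q : {poly K}, (map_poly iota q).[x] != 0 /\
             z = (map_poly iota p).[x] / (map_poly iota q).[x]].

Definition function_field : Prop :=
  exists2 x : F, ~ algebraic x &
    exists (n : nat) (b : 'I_n -> F), forall y : F,
      exists2 c : 'I_n -> F, (forall i, simple_ext x (c i)) &
        y = \sum_(i < n) c i * b i.

Definition full_constant_field : Prop :=
  forall z : F, algebraic z -> range iota z.

(** [n] is the dimension over K of the quotient V/W of K-subspaces of F:
    the classes of the [e i] form a basis. *)
Definition is_kdim (V W : set F) (n : nat) : Prop :=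
  exists2 e : 'I_n -> F, (forall i, V (e i)) &
    forall z, V z ->
      exists! c : {ffun 'I_n -> K}, W (z - \sum_(i < n) iota (c i) * e i).

(** Meaningful for finite-dimensional quotients only; 0 otherwise. *)
Definition kdim (V W : set F) : nat := xget 0%N [set n | is_kdim V W n].

Definition valuation_ring (O : set F) : Prop :=
  [/\ forall x y, O x -> O y -> O (x - y) /\ O (x * y),
      range iota `<` O,
      O `<` [set: F] &
      forall z, O z \/ O z^-1].

(** A place is the maximal ideal of a valuation ring; since the ideal and the
    ring determine each other, a place is encoded by its ring. *)
Record place := Place {
  place_ring : set F;
  _ : valuation_ring place_ring }.

HB.instance Definition _ := gen_eqMixin place.
HB.instance Definition _ := gen_choiceMixin place.

Definition place_unit (P : place) : set F :=
  [set z | [/\ z != 0, place_ring P z & place_ring P z^-1]].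

Definition place_ideal (P : place) : set F := place_ring P `\` place_unit P.

Definition place_degree (P : place) : nat :=
  kdim (place_ring P) (place_ideal P).

Definition prime_element (P : place) (t : F) : Prop :=
  place_ideal P = [set t * w | w in place_ring P].

(** The normalized valuation v_P(z); only relevant for z != 0. *)
Definition valuation (P : place) (z : F) : int :=
  xget 0 [set n : int | exists t u,
            [/\ prime_element P t, place_unit P u & z = t ^ n * u]].

Definition divisor (D : place -> int) : Prop :=
  finite_set [set P | D P != 0].

Definition div_degree (D : place -> int) : int :=
  \sum_(P \in [set: place]) D P * (place_degree P)%:Z.

Definition riemann_roch_space (D : place -> int) : set F :=
  [set z | z = 0 \/ forall P, 0 <= valuation P z + D P].

Definition rr_dim (D : place -> int) : nat :=
  kdim (riemann_roch_space D) [set 0].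

(** The genus is the maximum of deg A - l(A) + 1 over all divisors A. *)
Definition is_genus (g : nat) : Prop :=
  (exists2 A, divisor A & div_degree A - (rr_dim A)%:Z + 1 = g%:Z) /\
  (forall A, divisor A -> div_degree A - (rr_dim A)%:Z + 1 <= g%:Z).

(** N_1; [fset_set] is meaningful because this set is finite when K is. *)
Definition num_rational_places : nat :=
  #|` fset_set [set P : place | place_degree P = 1%N] |.

(** The number A_n of effective divisors of degree n, finite when K is. *)
Definition num_effective (n : nat) : nat :=
  #|` fset_set [set D : place -> int |
        [/\ divisor D, forall P, 0 <= D P & div_degree D = n%:Z]] |.

End FunctionField.

(** L(t) = (1 - t)(1 - q t) Z(t) as formal power series, where q = #|K| and
    Z(t) = sum_n A_n t^n is the Zeta function. *)
Definition is_Lpolynomial (K : finFieldType) (F : fieldType)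
    (iota : {rmorphism K -> F}) (L : {poly int}) : Prop :=
  forall n : nat,
    L`_n = \sum_(i < n.+1) ((1 - 'X) * (1 - #|K|%:Z *: 'X) : {poly int})`_i
                            * (num_effective iota (n - i))%:Z.

Definition composition (n : nat) : set (seq nat) :=
  [set m | [/\ (0 < size m)%N, all (fun k => 0 < k)%N m & sumn m = n]].

(** The numbers a_{n,theta} (for genus g); indices s start at 0.
    Beware that a_{1,theta} = 0 when g = 1. *)
Definition a_theta (R : realType) (g : nat) (theta : R) (n : nat) : R :=
  if n is 0%N then 1 else
  \sum_(m \in composition n)
    (-1) ^+ size m * 2 ^+ size m * 2 `^ (n%:R / 2) *
    \prod_(s < size m)
      (((g%:R - 1) * cos ((nth 0%N m s)%:R * theta)
         + cos ((nth 0%N m s)%:R * (pi / 2)))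
       / (sumn (take s.+1 m))%:R).

(** The tuple (2, ..., 2, 0) with g entries. *)
Definition tuple_2_0 (R : realType) (g : nat) : 'rV[R[i]%C]_g :=
  \row_(i < g) (if i.+1 == g then 0 else 2).

(* Main.v *)
Require Import Defs.
From HB Require Import structures.
From mathcomp Require Import all_boot all_order all_algebra.
From mathcomp Require Import finmap.
From mathcomp Require Import complex.
From mathcomp Require Import all_classical all_reals all_analysis.
From mathcomp Require Import ring lra.

(** Write the L-polynomial as [\prod_z (1 - z t)], with [z] running over the
    [alpha i] and their conjugates. Newton's identities give
    [n a_n = - \sum_(1 <= k <= n) s_k a_(n-k)], where [s_k] is the sum of the
    [z ^+ k] ([newton_identity]). The sum over compositions that defines
    [a_theta] satisfies a recurrence of the same shape: in the summand of
    [(m_1, ..., m_r)], the last denominator is [m_1 + ... + m_r = n], so after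
    multiplication by [n] the last part [k = m_r] contributes only its weight
    [- 2 * 2 ^ (k / 2) * ((g - 1) cos (k theta) + cos (k pi / 2))], and what
    remains is a composition of [n - k] ([comp_sum_newton]).
    Such a recurrence determines its solution from the value at 0
    ([newton_rec_uniq]).

    These weights are the [- s_k]. Since
    [alpha i * (alpha i)^* = 2], the traces of the powers of [alpha i] satisfy
    [u_(m+2) = t u_(m+1) - 2 u_m], [u_0 = 2], [u_1 = t], where [t] is the trace
    of [alpha i]; and so does [2 * (sqrt 2)^m * cos (m phi)] when
    [2 * sqrt 2 * cos phi = t]. The traces 2, -2 and 0 correspond to the angles
    [pi / 4], [3 pi / 4] and [pi / 2]. So [L] has the coefficients [a_theta],
    and the [a_theta] are integers determined by an integer recurrence.

    Passing from [t] to [-t] multiplies [s_k] by [(-1)^k], hence [a_n] by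
    [(-1)^n]; so everything about signs and growth follows from the case
    [3 pi / 4]. There [L(t)] is [(1 + 2 t + 2 t^2)^(g-1) (1 + 2 t^2)], whose
    coefficients up to degree [g] are positive and strictly increasing for each
    [g] from 2 to 6; they are tabulated in [abs_coef] and checked against the
    recurrence by computation. *)

Set Implicit Arguments.
Unset Strict Implicit.
Unset Printing Implicit Defensive.
Import Order.TTheory GRing.Theory Num.Theory.
Local Open Scope ring_scope.

(** * Newton's identities for the inverse roots of a polynomial *)

(** Induction on the roots: multiplying [p] by [1 - z X] adds [z ^+ k] to the
    [k]-th power sum, and the sum of the new terms telescopes ([geom]). *)
Lemma newton_identity (A : comNzRingType) (zs : seq A) (n : nat) :
  let p := \prod_(z <- zs) (1 - z *: 'X) : {poly A} in
  n.+1%:R * p`_n.+1 =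
    \sum_(k < n.+1) (- \sum_(z <- zs) z ^+ k.+1) * p`_(n - k).
Proof.
elim: zs n => [|z zs IH] n /=.
  rewrite !big_nil coef1 mulr0 big1 // => k _.
  by rewrite big_nil oppr0 mul0r.
move: IH; rewrite /= big_cons; set p := \prod_(y <- zs) _ => IH.
have coefS k : ((1 - z *: 'X) * p)`_k.+1 = p`_k.+1 - z * p`_k.
  by rewrite mulrBl mul1r -scalerAl coefB coefZ coefXM.
have coef0 : ((1 - z *: 'X) * p)`_0 = p`_0.
  by rewrite mulrBl mul1r -scalerAl coefB coefZ coefXM mulr0 subr0.
set q := _ * p in coefS coef0 *.
have geom m : \sum_(k < m.+1) z ^+ k.+1 * q`_(m - k) = z * p`_m.
  elim: m => [|m IHm]; first by rewrite big_ord1 coef0 expr1.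
  rewrite big_ord_recl subn0 coefS /=.
  under eq_bigr do rewrite /bump /= add1n subSS exprS -mulrA.
  by rewrite -mulr_sumr IHm; ring.
have old : \sum_(k < n.+1) (- \sum_(y <- zs) y ^+ k.+1) * q`_(n - k) =
    n.+1%:R * p`_n.+1 - z * (n%:R * p`_n).
  rewrite IH big_ord_recr /= subnn coef0.
  rewrite [in RHS]big_ord_recr /= subnn.
  rewrite addrAC; congr (_ + _).
  case: n {geom} => [|n]; first by rewrite !big_ord0 mul0r mulr0 subr0.
  rewrite IH mulr_sumr -sumrB; apply: eq_bigr => k _.
  have kn := ltn_ord k; rewrite subSn // coefS; ring.
under eq_bigr do rewrite big_cons opprD mulrDl.
rewrite big_split /= old.
under eq_bigr do rewrite mulNr.
by rewrite sumrN geom coefS -natr1; ring.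
Qed.

(** * Sums over compositions *)

Section Compositions.
Local Open Scope classical_set_scope.

(** Allowing the empty sequence when [n = 0] makes the recursion uniform: it is
    what is left of a composition with a single part once that part is
    removed. *)
Definition composition_or_nil (n : nat) : set (seq nat) :=
  [set m | all (fun k => 0 < k)%N m /\ sumn m = n].

Lemma composition_or_nil0 : composition_or_nil 0 = [set [::]].
Proof.
apply/seteqP; split => [m [] | m ->] //=.
by case: m => [|k m] //= /andP[k_gt0 _]; case: k k_gt0.
Qed.

Lemma composition_pos n : composition n.+1 = composition_or_nil n.+1.
Proof.
apply/seteqP; split => [m [_ m_pos m_sum] | m [m_pos m_sum]]; split => //.
by case: m m_sum {m_pos}.
Qed.

Lemma composition_or_nil_last n k : (k <= n)%N ->
  composition_or_nil n.+1 `&` [set m | last 0%N m = k.+1] =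
  (fun m => rcons m k.+1) @` composition_or_nil (n - k).
Proof.
move=> le_kn; apply/seteqP; split => [m [[]] | _ [m [m_pos m_sum] <-]] /=.
  elim/last_ind: m => [|m j _] //; rewrite all_rcons sumn_rcons last_rcons.
  move=> /andP[_ m_pos] + jk; rewrite jk => m_sum; exists m => //; split => //.
  by apply/eqP; rewrite -(eqn_add2r k.+1) m_sum addnS subnK.
split; last by rewrite last_rcons.
by split; rewrite ?all_rcons ?m_pos // sumn_rcons m_sum addnS subnK.
Qed.

Lemma composition_or_nil_last_lt n m :
  composition_or_nil n.+1 m -> exists k : 'I_n.+1, last 0%N m = k.+1.
Proof.
case; elim/last_ind: m => [|m j _] //.
rewrite all_rcons sumn_rcons last_rcons => /andP[j_gt0 _] m_sum.
have lt_jn : (j.-1 < n.+1)%N by rewrite -m_sum prednK // leq_addl.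
by exists (Ordinal lt_jn); rewrite /= prednK.
Qed.

Lemma finite_composition_or_nil n : finite_set (composition_or_nil n).
Proof.
elim/ltn_ind: n => -[|n] IH; first by rewrite composition_or_nil0.
apply: (@sub_finite_set _ _
  (\bigcup_(k in `I_n.+1)
     ((fun m => rcons m k.+1) @` composition_or_nil (n - k)))).
  move=> m mn; have [k mk] := composition_or_nil_last_lt mn.
  exists k; first exact: ltn_ord.
  by have <- : _ = _ := @composition_or_nil_last n k (ltn_ord k).
apply: bigcup_finite => // k _; apply: finite_image.
by apply: IH; rewrite ltnS leq_subr.
Qed.

(** A nonempty composition is classified by its last part, and removing that
    part is a bijection. *)
Lemma sum_composition_or_nilS (R : nmodType) (F : seq nat -> R) n :
  \sum_(m \in composition_or_nil n.+1) F m =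
  \sum_(k < n.+1) \sum_(m \in composition_or_nil (n - k)) F (rcons m k.+1).
Proof.
(* Insert the indicator of the value of the last part, then exchange sums. *)
transitivity (\sum_(m \in composition_or_nil n.+1)
    \sum_(k < n.+1) if last 0%N m == k.+1 then F m else 0).
  apply: eq_fsbigr => m /set_mem mn.
  have [k mk] := composition_or_nil_last_lt mn.
  rewrite -big_mkcond (big_pred1 k) // => i /=.
  by rewrite mk eqSS eq_sym.
rewrite fsbig_finite; last exact: finite_composition_or_nil.
rewrite exchange_big /=; apply: eq_bigr => k _.
rewrite -fsbig_finite; last exact: finite_composition_or_nil.
rewrite -(fsbig_image _ (fun m => rcons m k.+1)); last first.
  by move=> m1 m2 _ _ /rcons_inj[].
rewrite -(@composition_or_nil_last n k) -1?ltnS // [RHS]fsbig_mkcondr.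
apply: eq_fsbigr => m _; congr (if _ then _ else _).
by apply/eqP/idP => [mk|/set_mem]; rewrite ?inE.
Qed.

Definition comp_weight (R : fieldType) (b : nat -> R) (m : seq nat) : R :=
  \prod_(s < size m) (b (nth 0%N m s) / (sumn (take s.+1 m))%:R).

Definition comp_sum (R : fieldType) (b : nat -> R) (n : nat) : R :=
  \sum_(m \in composition_or_nil n) comp_weight b m.

Lemma comp_weight_rcons (R : fieldType) (b : nat -> R) m k :
  comp_weight b (rcons m k) = comp_weight b m * (b k / (sumn m + k)%:R).
Proof.
rewrite /comp_weight size_rcons big_ord_recr /=.
rewrite nth_rcons ltnn eqxx take_oversize ?size_rcons // sumn_rcons.
congr (_ * _); apply: eq_bigr => s _.
by rewrite nth_rcons ltn_ord -cats1 takel_cat.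
Qed.

Lemma comp_sum0 (R : fieldType) (b : nat -> R) : comp_sum b 0 = 1.
Proof.
by rewrite /comp_sum composition_or_nil0 fsbig_set1 /comp_weight big_ord0.
Qed.

End Compositions.

(** * The Newton recurrence *)

Definition newton_rec (A : nzRingType) (b a : nat -> A) (n : nat) : Prop :=
  n.+1%:R * a n.+1 = \sum_(k < n.+1) b k.+1 * a (n - k)%N.

(** The last partial sum of a composition of [n.+1] is [n.+1], so the factor
    [n.+1] cancels the last denominator and only the weight of the last part
    remains. *)
Lemma comp_sum_newton (R : numFieldType) (b : nat -> R) (n : nat) :
  newton_rec b (comp_sum b) n.
Proof.
rewrite /newton_rec /comp_sum sum_composition_or_nilS mulr_sumr.
apply: eq_bigr => k _; rewrite !mulr_fsumr; apply: eq_fsbigr => m.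
move=> /set_mem[_ m_sum]; rewrite comp_weight_rcons m_sum.
rewrite addnS subnK -1?ltnS //; field.
by rewrite addrC natr1 pnatr_eq0.
Qed.

Lemma newton_rec_uniq (R : numFieldType) (b a a' : nat -> R) (N : nat) :
  a 0%N = a' 0%N ->
  (forall n, (n < N)%N -> newton_rec b a n) ->
  (forall n, (n < N)%N -> newton_rec b a' n) ->
  forall n, (n <= N)%N -> a n = a' n.
Proof.
move=> a0 recN recN' n; elim/ltn_ind: n => -[|n] IH // lt_nN.
apply: (@mulfI R n.+1%:R); first by rewrite pnatr_eq0.
rewrite recN // recN' //; apply: eq_bigr => k _; congr (_ * _).
have le_n : (n - k <= n)%N by exact: leq_subr.
by apply: IH => //; exact: leq_trans le_n (ltnW lt_nN).
Qed.

Lemma newton_rec_int (A : nzRingType) (b a : nat -> int) (n : nat) :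
  newton_rec b a n ->
  newton_rec (fun k => (b k)%:~R : A) (fun k => (a k)%:~R) n.
Proof.
move=> /(congr1 (fun z : int => z%:~R : A)).
rewrite rmorphM rmorph_nat rmorph_sum /newton_rec => ->.
by apply: eq_bigr => k _; rewrite rmorphM.
Qed.

(** Substituting [- X] for [X] in the generating functions. *)
Lemma newton_rec_alternate (A : comNzRingType) (b a : nat -> A) (n : nat) :
  newton_rec b a n ->
  newton_rec (fun k => (-1) ^+ k * b k) (fun k => (-1) ^+ k * a k) n.
Proof.
rewrite /newton_rec mulrCA => ->; rewrite mulr_sumr.
apply: eq_bigr => k _; rewrite mulrACA -exprD addSn subnKC -1?ltnS //.
Qed.

(** * Lucas sequences *)

(** The Lucas sequence [V_m(t, 2)]: the power sums of the roots of
    [X^2 - t X + 2]. Taking [t] in [int] allows the later use of computation. *)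
Fixpoint lucas (t : int) (m : nat) : int :=
  match m with
  | 0 => 2
  | m1.+1 => match m1 with 0 => t | m2.+1 => t * lucas t m1 - 2 * lucas t m2 end
  end.

Lemma lucasSS t m : lucas t m.+2 = t * lucas t m.+1 - 2 * lucas t m.
Proof. by []. Qed.

Lemma lucas_uniq (A : nzRingType) (t : int) (u : nat -> A) :
  u 0%N = 2 -> u 1%N = t%:~R ->
  (forall m, u m.+2 = t%:~R * u m.+1 - 2 * u m) ->
  forall m, u m = (lucas t m)%:~R.
Proof.
move=> u0 u1 uSS m; elim/ltn_ind: m => -[|[|m]] IH //.
by rewrite lucasSS uSS !IH // rmorphB !rmorphM.
Qed.

Lemma lucas_sumX (A : comNzRingType) (x y : A) (t : int) :
  x + y = t%:~R -> x * y = 2 -> forall m, x ^+ m + y ^+ m = (lucas t m)%:~R.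
Proof.
move=> xDy xMy; apply: lucas_uniq => [|//|m]; first by rewrite !expr0.
by rewrite -xDy -xMy !exprS; ring.
Qed.

(** The addition formulas give
    [cos ((m + 2) phi) = 2 cos phi cos ((m + 1) phi) - cos (m phi)]. *)
Lemma lucas_cos (R : realType) (phi : R) (t : int) :
  2 * Num.sqrt 2 * cos phi = t%:~R ->
  forall m, 2 * Num.sqrt 2 ^+ m * cos (m%:R * phi) = (lucas t m)%:~R.
Proof.
move=> tE; apply: lucas_uniq => [||m].
- by rewrite mul0r cos0 !mulr1.
- by rewrite expr1 mul1r.
have -> : m.+2%:R * phi = m.+1%:R * phi + phi by rewrite -natr1; ring.
have -> : m%:R * phi = m.+1%:R * phi - phi by rewrite -natr1; ring.
rewrite cosD cosB -tE !exprS.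
have s2 : Num.sqrt 2 * Num.sqrt 2 = 2 :> R by rewrite -expr2 sqr_sqrtr.
by set s := Num.sqrt 2 in s2 *; ring: s2.
Qed.

Lemma lucasN (t : int) m : lucas (- t) m = (-1) ^+ m * lucas t m.
Proof.
elim/ltn_ind: m => -[|[|m]] IH; rewrite ?mul1r ?mulN1r //.
by rewrite !lucasSS !IH // !exprS; ring.
Qed.

(** The [m]-th power sum of the [2 g] inverse roots when [g - 1] of the traces
    are [t] and one is 0. *)
Definition trace_sum (g : nat) (t : int) (m : nat) : int :=
  (g%:Z - 1) * lucas t m + lucas 0 m.

Lemma trace_sumN g t m : trace_sum g (- t) m = (-1) ^+ m * trace_sum g t m.
Proof.
have lucas0 : lucas 0 m = (-1) ^+ m * lucas 0 m := lucasN 0 m.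
by rewrite /trace_sum lucasN {1}lucas0; ring.
Qed.

(** * Integrality of the numbers [a_theta] *)

(** The factors [-2] and [2 ^ (n / 2)] of a summand are distributed over the
    parts: a part [m] receives [-2] and [(sqrt 2) ^ m], which turns its cosines
    into Lucas numbers. *)
Lemma a_theta_comp_sum (R : realType) (g : nat) (theta : R) (t : int) :
  2 * Num.sqrt 2 * cos theta = t%:~R ->
  a_theta g theta = comp_sum (fun m => (- trace_sum g t m)%:~R).
Proof.
move=> tE; apply/funext => -[|n]; first by rewrite comp_sum0.
have t0E : 2 * Num.sqrt 2 * cos (pi / 2 : R) = 0%:~R.
  by rewrite cos_pihalf mulr0.
rewrite /a_theta composition_pos; apply: eq_fsbigr => m /set_mem[_ m_sum].
have -> : 2 `^ (n.+1%:R / 2) =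
    \prod_(s < size m) Num.sqrt 2 ^+ nth 0%N m s :> R.
  have sum_nth : (\sum_(s < size m) nth 0%N m s = n.+1)%N.
    by rewrite -m_sum sumnE (big_nth 0%N) big_mkord.
  rewrite prodrXr sum_nth.
  by rewrite mulrC powRrM powR12_sqrt // powR_mulrn // sqrtr_ge0.
rewrite -exprMn.
have <- : \prod_(s < size m) (-1 * 2) = (-1 * 2) ^+ size m :> R.
  by rewrite prodr_const card_ord.
rewrite -!big_split /=.
apply: eq_bigr => s _; rewrite [LHS]mulrA; congr (_ * _).
rewrite /trace_sum rmorphN rmorphD rmorphM rmorphB /= -pmulrn.
by rewrite -(lucas_cos tE) -(lucas_cos t0E); ring.
Qed.

Lemma a_theta_newton (R : realType) (g N : nat) (theta : R) (t : int)
    (a : nat -> int) :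
  2 * Num.sqrt 2 * cos theta = t%:~R -> a 0%N = 1 ->
  (forall n, (n < N)%N -> newton_rec (fun m => - trace_sum g t m) a n) ->
  forall n, (n <= N)%N -> a_theta g theta n = (a n)%:~R.
Proof.
move=> tE a0 a_rec; rewrite (a_theta_comp_sum g tE).
apply: newton_rec_uniq => [|n _|n lt_nN]; first by rewrite comp_sum0 a0.
  exact: comp_sum_newton.
exact: newton_rec_int (a_rec n lt_nN).
Qed.

(** Duplication gives [2 cos (pi / 4) ^ 2 - 1 = cos (pi / 2) = 0], and the
    cosine is positive. *)
Lemma sqrt2_cos_pi4 (R : realType) : Num.sqrt 2 * cos (pi / 4) = 1 :> R.
Proof.
have pi_gt0 := pi_gt0 R.
have cos_gt0 : 0 < cos (pi / 4 : R).
  by apply: cos_gt0_pihalf; apply/andP; split; lra.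
have := cos_mulr2n (pi / 4 : R).
rewrite (_ : pi / 4 *+ 2 = pi / 2); last by field.
rewrite cos_pihalf => cos2E.
apply/eqP; rewrite -(@eqrXn2 _ 2) ?mulr_ge0 ?sqrtr_ge0 ?ltW //.
by rewrite exprMn sqr_sqrtr // expr1n; apply/eqP; lra.
Qed.

Lemma sqrt2_cos_3pi4 (R : realType) : Num.sqrt 2 * cos (3 * pi / 4) = -1 :> R.
Proof.
rewrite (_ : 3 * pi / 4 = - (pi / 4) + pi); last by field.
by rewrite cosDpi cosN mulrN sqrt2_cos_pi4.
Qed.

(** * The coefficients of the L-polynomial *)

(** Each pair of conjugate inverse roots contributes a Lucas number to the
    power sums. The recurrence holds over [C] and descends to [int] because
    the weights and the coefficients are integers. *)
Lemma Lpoly_newton (C : numClosedFieldType) (g : nat) (L : {poly int})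
    (alpha : 'I_g.+1 -> C) (t : int) :
  map_poly intr L =
    \prod_(i < g.+1) ((1 - alpha i *: 'X) * (1 - (alpha i)^* *: 'X)) ->
  (forall i, alpha i * (alpha i)^* = 2) ->
  (forall i : 'I_g.+1,
     alpha i + (alpha i)^* = (if i.+1 == g.+1 then 0 else t)%:~R) ->
  L`_0 = 1 /\
  forall n, newton_rec (fun m => - trace_sum g.+1 t m) (fun n => L`_n) n.
Proof.
move=> L_factors alpha_prod alpha_tr.
pose zs := [seq alpha i | i : 'I_g.+1] ++ [seq (alpha i)^* | i : 'I_g.+1].
have LE : map_poly intr L = \prod_(z <- zs) (1 - z *: 'X).
  by rewrite L_factors big_split big_cat !big_image.
have coefL n : (map_poly intr L)`_n = (L`_n)%:~R :> C by rewrite coef_map_id0.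
split.
  apply: (@intr_inj C); rewrite -coefL LE -horner_coef0 horner_prod.
  by rewrite big1 => [|z _]; rewrite ?hornerE ?mulr0 ?subr0.
move=> n; apply: (@intr_inj C).
have := newton_identity zs n; rewrite /= -LE coefL rmorphM rmorph_nat => ->.
rewrite rmorph_sum; apply: eq_bigr => k _; rewrite coefL rmorphM rmorphN /=.
congr (- _ * _); rewrite big_cat !big_image /= -big_split /=.
transitivity (\sum_(i < g.+1)
    (lucas (if i.+1 == g.+1 then 0 else t) k.+1)%:~R : C).
  by apply: eq_bigr => i _; apply: lucas_sumX.
rewrite big_ord_recr /= eqxx.
under eq_bigr => i _ do rewrite eqSS ltn_eqF //.
rewrite sumr_const card_ord /trace_sum rmorphD rmorphM rmorphB /=.
by rewrite -mulr_natl -natr1; ring.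
Qed.



(** * Signs and growth for genus 2 to 6 *)

(** The coefficients up to degree [g] of
    [(1 + 2 t + 2 t^2)^(g-1) (1 + 2 t^2)]. *)
Definition abs_coef (g : nat) : nat -> nat :=
  nth 0%N match g with
  | 2 => [:: 1; 2; 4]
  | 3 => [:: 1; 4; 10; 16]
  | 4 => [:: 1; 6; 20; 44; 72]
  | 5 => [:: 1; 8; 34; 96; 200; 320]
  | 6 => [:: 1; 10; 52; 180; 460; 912; 1440]
  | _ => [::]
  end%N.

Lemma abs_coef_newton (g : nat) : (2 <= g <= 6)%N ->
  forall n, (n < g)%N ->
    newton_rec (fun m => - trace_sum g (-2) m) (fun n => (abs_coef g n)%:Z) n.
Proof.
move: g => [|[|[|[|[|[|[|g]]]]]]] //= _ [|[|[|[|[|[|n]]]]]] //= _;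
  by rewrite /newton_rec !big_ord_recr big_ord0 /=.
Qed.

Lemma abs_coef_incr (g : nat) : (2 <= g <= 6)%N ->
  forall m n, (m < n <= g)%N -> (abs_coef g m < abs_coef g n)%N.
Proof.
move=> g_range m n /andP[lt_mn le_ng].
(* Transitivity reduces the claim to consecutive entries. *)
suff step k : (k < g)%N -> (abs_coef g k < abs_coef g k.+1)%N.
  elim: n lt_mn le_ng => // n IH.
  rewrite ltnS leq_eqVlt => /predU1P[->|lt_mn] lt_ng.
    exact: step.
  by apply: ltn_trans (step _ lt_ng); apply: IH (ltnW lt_ng).
by move: g g_range {le_ng} => [|[|[|[|[|[|[|g]]]]]]] //= _;
  move: k => [|[|[|[|[|[|k]]]]]].
Qed.

Lemma abs_coef_gt0 (g n : nat) : (2 <= g <= 6)%N -> (n <= g)%N ->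
  (0 < abs_coef g n)%N.
Proof.
move=> g_range; case: n => [|n] le_ng.
  by move: g g_range {le_ng} => [|[|[|[|[|[|[|g]]]]]]].
by apply: leq_ltn_trans (@abs_coef_incr g g_range 0%N n.+1 _).
Qed.

Lemma a_theta_3pi4 (R : realType) (g n : nat) : (2 <= g <= 6)%N -> (n <= g)%N ->
  a_theta g (3 * pi / 4 : R) n = (abs_coef g n)%:R.
Proof.
move=> g_range le_ng; rewrite [RHS]pmulrn.
apply: (@a_theta_newton R g g _ (-2) (fun n => (abs_coef g n)%:Z)) le_ng.
- by rewrite -mulrA sqrt2_cos_3pi4 mulrN1.
- by move: g g_range => [|[|[|[|[|[|[|g]]]]]]].
- exact: abs_coef_newton.
Qed.

Lemma a_theta_pi4 (R : realType) (g n : nat) : (2 <= g <= 6)%N -> (n <= g)%N ->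
  a_theta g (pi / 4 : R) n = (-1) ^+ n * (abs_coef g n)%:R.
Proof.
move=> g_range le_ng.
transitivity (((-1) ^+ n * (abs_coef g n)%:Z)%:~R : R); last first.
  by rewrite rmorphM rmorphXn rmorphN1.
apply: (@a_theta_newton R g g _ 2
  (fun n => (-1) ^+ n * (abs_coef g n)%:Z)) le_ng.
- by rewrite -mulrA sqrt2_cos_pi4 mulr1.
- by move: g g_range => [|[|[|[|[|[|[|g]]]]]]].
move=> k lt_kg; have := newton_rec_alternate (abs_coef_newton g_range lt_kg).
rewrite /newton_rec => ->; apply: eq_bigr => j _; congr (_ * _).
by rewrite mulrN -trace_sumN.
Qed.

Theorem theorem4p8 (R : realType) (F : fieldType)
    (iota : {rmorphism 'F_2 -> F}) (g : nat) (L : {poly int})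
    (alpha : 'I_g -> R[i]%C)
    (F_function_field : function_field iota)
    (F_constants : full_constant_field iota)
    (F_genus : is_genus iota g)
    (g_range : (1 <= g <= 6)%N)
    (L_poly : is_Lpolynomial iota L)
    (L_factors : map_poly intr L =
       \prod_(i < g) ((1 - alpha i *: 'X) * (1 - (alpha i)^* *: 'X)))
    (alpha_norm : forall i, `|alpha i| = (Num.sqrt (2 : R))%:C%C)
    (N1_defect : `|(num_rational_places iota)%:Z - 3| = 2 * g%:Z - 2)
    (alpha_trace :
       \row_(i < g) (alpha i + (alpha i)^*) = tuple_2_0 R g \/
       \row_(i < g) (alpha i + (alpha i)^*) = - tuple_2_0 R g) :
  [/\ \row_(i < g) (alpha i + (alpha i)^*) = tuple_2_0 R g ->
        forall n, (n <= g)%N -> (L`_n)%:~R = a_theta g (pi / 4 : R) n,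
      \row_(i < g) (alpha i + (alpha i)^*) = - tuple_2_0 R g ->
        forall n, (n <= g)%N -> (L`_n)%:~R = a_theta g (3 * pi / 4 : R) n &
      (2 <= g)%N ->
      [/\ forall n, (n <= g)%N ->
            (odd n -> a_theta g (pi / 4 : R) n < 0) /\
            (~~ odd n -> 0 < a_theta g (pi / 4 : R) n),
          forall n, (n <= g)%N -> 0 < a_theta g (3 * pi / 4 : R) n &
          forall theta : R, theta = pi / 4 \/ theta = 3 * pi / 4 ->
            forall m n, (m < n <= g)%N ->
              `|a_theta g theta m| < `|a_theta g theta n|]].
Proof.
have L_a_theta (t : int) (theta : R) :
    2 * Num.sqrt 2 * cos theta = t%:~R ->
    (forall i, alpha i + (alpha i)^* = (if i.+1 == g then 0 else t)%:~R) ->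
    forall n, (n <= g)%N -> (L`_n)%:~R = a_theta g theta n.
  case: g g_range alpha L_factors alpha_norm
    {F_genus N1_defect alpha_trace} => //.
  move=> g _ alpha L_factors alpha_norm tE alpha_tr n le_n.
  have alpha_prod i : alpha i * (alpha i)^* = 2.
    by rewrite -normCK alpha_norm -rmorphXn sqr_sqrtr // rmorph_nat.
  have [L0 L_rec] := Lpoly_newton L_factors alpha_prod alpha_tr.
  by rewrite (a_theta_newton tE L0 _ le_n).
split.
- move=> /rowP tr; apply: (L_a_theta 2) => [|i].
    by rewrite -mulrA sqrt2_cos_pi4 mulr1.
  by move: (tr i); rewrite !mxE => ->; case: ifP.
- move=> /rowP tr; apply: (L_a_theta (-2)) => [|i].
    by rewrite -mulrA sqrt2_cos_3pi4 mulrN1.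
  by move: (tr i); rewrite !mxE => ->; case: ifP; rewrite ?oppr0 ?rmorphN.
move=> g_ge2; have {}g_range : (2 <= g <= 6)%N.
  by rewrite g_ge2; case/andP: g_range.
split.
- move=> n le_ng; rewrite a_theta_pi4 // -signr_odd.
  have := abs_coef_gt0 g_range le_ng; rewrite -(ltr0n R) => c_gt0.
  by case: (odd n); split=> // _; rewrite ?expr1 ?mulN1r ?oppr_lt0 // mul1r.
- by move=> n le_ng; rewrite a_theta_3pi4 // ltr0n abs_coef_gt0.
move=> theta theta_eq m n mn; have /andP[lt_mn le_ng] := mn.
have le_mg : (m <= g)%N by apply: leq_trans (ltnW lt_mn) le_ng.
have norm_a k : (k <= g)%N -> `|a_theta g theta k| = (abs_coef g k)%:R.
  case: theta_eq => -> le_kg.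
    by rewrite a_theta_pi4 // normrMsign normr_nat.
  by rewrite a_theta_3pi4 // normr_nat.
by rewrite !norm_a // ltr_nat abs_coef_incr.
Qed.
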